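(* Consider any decision problem with $n=|A|$ a priori homogeneous actions. A stochastic choice rule $P\in\Delta(A)^\Theta$ is ex-ante symmetric and optimal under Csiszár information with transformation $\phi$ if and only if $P$ is optimal under additive perturbed utility (APU) with the perturbation function $$c(t)=\frac1n\phi(nt)\qquad\forall t\in[0,1].\tag{$*$}$$ Moreover, for any perturbation function $c$ that satisfies the normalization $c(1/n)=0$ and $0\in\partial c(1/n)$, there exists a Csiszár information transformation $\phi$ that satisfies $( * )$.
   Context: Decision problem with a priori homogeneous actions: the action set is enumerated as $A=\{a_1,\dots,a_n\}$ (with $n$ distinct actions), the state space $\Theta$ is a finite subset of $\mathbb{R}^n$, $a_i(\theta)=\theta_i$ is the utility of action $a_i$ in state $\theta=(\theta_1,\dots,\theta_n)$, and $\pi\in\Delta(\Theta)$ is a full-support prior. Actions are a priori homogeneous if for every $\theta\in\Theta$ and every permutation $\gamma$ of $\{1,\dots,n\}$, $\theta_\gamma=(\theta_{\gamma(1)},\dots,\theta_{\gamma(n)})\in\Theta$ and $\pi(\theta)=\pi(\theta_\gamma)$. Csiszár information transformation: a convex, lower semicontinuous $\phi:\mathbb{R}_+\to[0,+\infty]$ with $\phi(1)=0$ which (standing assumption) is superlinear at infinity ($\phi(t)/t\to+\infty$ as $t\to+\infty$), strictly convex on $\operatorname{int}(\operatorname{dom}\phi)$, and satisfies $1\in\operatorname{int}(\operatorname{dom}\phi)$. The Csiszár information of $P\in\Delta(A)^\Theta$ is $$I(P,\pi)=\min_{\alpha\in\Delta(A)}\sum_{\theta}\pi(\theta)\sum_{a\in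 A}\alpha(a)\phi\Big(\frac{P_\theta(a)}{\alpha(a)}\Big),$$ with $0\cdot\phi(x/0)=\lim_{t\to+\infty}\phi(1+tx)/t$. A minimizer $\alpha$ is an $f$-mean of $P$. $P$ is optimal under Csiszár information if it maximizes $\sum_\theta\pi(\theta)\sum_aP_\theta(a)a(\theta)-I(P,\pi)$ over $\Delta(A)^\Theta$. An optimal choice rule $P$ is ex-ante symmetric if its associated $f$-mean is uniform, i.e. the uniform distribution on $A$ is an $f$-mean of $P$. APU: a perturbation function is a convex function $c:[0,1]\to\mathbb{R}\cup\{+\infty\}$ that is lower semicontinuous, strictly convex on $\operatorname{int}(\operatorname{dom}c)$, and such that $1/n\in\operatorname{int}(\operatorname{dom}c)$. $P$ is optimal under APU with $c$ if for every $\theta\in\Theta$, $P_\theta\in\arg\max_{p\in\Delta(A)}\sum_{a\in A}[p(a)a(\theta)-c(p(a))]$. *)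

(* Defs.v *)
From HB Require Import structures.
From mathcomp Require Import all_boot all_order all_algebra perm finmap.
From mathcomp Require Import all_classical all_reals all_analysis.

Set Implicit Arguments.
Unset Strict Implicit.
Unset Printing Implicit Defensive.

Import Order.TTheory GRing.Theory Num.Theory.
Import numFieldNormedType.Exports.

Local Open Scope classical_set_scope.
Local Open Scope ring_scope.

(* A function from D `<=` R to ]-oo, +oo] is a total [f : R -> \bar R] of which
   only the values on D are ever used. *)
Section ConvexAnalysis.
Context {R : realType}.
Implicit Types (D S : set R) (f : R -> \bar R).

Definition dom D f : set R := [set t | D t /\ (f t < +oo)%E].

(* With 0 * +oo = 0 in [\bar R], the cases l = 0 and l = 1 are trivial. *)
Definition ereal_convex D f : Prop :=
  forall x y l : R, D x -> D y -> 0 <= l <= 1 ->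
  (f (l * x + (1 - l) * y)%R <= l%:E * f x + (1 - l)%:E * f y)%E.

Definition ereal_strictly_convex S f : Prop :=
  forall x y l : R, S x -> S y -> x != y -> 0 < l < 1 ->
  (f (l * x + (1 - l) * y)%R < l%:E * f x + (1 - l)%:E * f y)%E.

(* [subspace D] makes semicontinuity relative to D (and trivial off D). *)
Definition lsc_on D f : Prop := lower_semicontinuous (f : subspace D -> \bar R).

Definition subdifferential D f (x : R) : set R :=
  [set s | forall y, D y -> (f x + (s * (y - x))%:E <= f y)%E].

End ConvexAnalysis.

Section Simplex.
Context {R : realType} {T : finType}.

(* Delta(T), with p t the mass of t *)
Definition simplex : set (T -> R) :=
  [set p | (forall t, 0 <= p t) /\ \sum_t p t = 1].

Definition uniform : T -> R := fun=> #|T|%:R^-1.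

End Simplex.

(* Actions are indexed by 'I_n and a state is a row vector theta, theta 0 i being
   the utility of action i. A finite set Theta of states is an [{fset _}], hence
   also the finite type of its elements. *)
Section DecisionProblem.
Context {R : realType} {n : nat} {Theta : {fset 'rV[R]_n}}.
Implicit Types (prior : Theta -> R) (P : Theta -> 'I_n -> R).

Definition full_support_prior prior : Prop :=
  simplex prior /\ forall theta, 0 < prior theta.

(* [col_perm g theta] has entries theta 0 (g i). *)
Definition a_priori_homogeneous prior : Prop :=
  forall (theta : Theta) (g : {perm 'I_n}),
  exists2 theta' : Theta,
    val theta' = col_perm g (val theta) & prior theta = prior theta'.

Definition choice_rule P : Prop := forall theta, simplex (P theta).

Definition expected_utility prior P : R :=
  \sum_theta prior theta * \sum_a P theta a * val theta 0 a.

End DecisionProblem.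

Section Csiszar.
Context {R : realType}.
Implicit Types phi : R -> \bar R.

Record csiszar_transformation phi : Prop := {
  csiszar_ge0 : forall t, 0 <= t -> (0 <= phi t)%E ;
  csiszar_convex : ereal_convex `[0, +oo[ phi ;
  csiszar_lsc : lsc_on `[0, +oo[ phi ;
  csiszar_one : phi 1 = 0%E ;
  csiszar_superlinear : (phi t * (t^-1)%:E)%E @[t --> +oo%R] --> +oo%E ;
  csiszar_strict : ereal_strictly_convex (interior (dom `[0, +oo[ phi)) phi ;
  csiszar_int1 : interior (dom `[0, +oo[ phi) 1
}.

(* a * phi (x / a), extended to a = 0 by its limit *)
Definition perspective phi (x a : R) : \bar R :=
  if a == 0 then lim ((phi (1 + t * x)%R * (t^-1)%:E)%E @[t --> +oo%R])
  else (a%:E * phi (x / a)%R)%E.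

Context {n : nat} {Theta : {fset 'rV[R]_n}}.
Implicit Types (prior : Theta -> R) (P : Theta -> 'I_n -> R).

Definition csiszar_cost phi prior P (alpha : 'I_n -> R) : \bar R :=
  (\sum_theta (prior theta)%:E *
     \sum_a perspective phi (P theta a) (alpha a))%E.

(* The infimum is attained whenever phi is a Csiszar transformation. *)
Definition csiszar_information phi prior P : \bar R :=
  ereal_inf [set csiszar_cost phi prior P alpha | alpha in simplex].

Definition f_mean phi prior P (alpha : 'I_n -> R) : Prop :=
  simplex alpha /\
  forall beta, simplex beta ->
    (csiszar_cost phi prior P alpha <= csiszar_cost phi prior P beta)%E.

Definition csiszar_objective phi prior P : \bar R :=
  ((expected_utility prior P)%:E - csiszar_information phi prior P)%E.

Definition csiszar_optimal phi prior P : Prop :=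
  choice_rule P /\
  forall Q, choice_rule Q ->
    (csiszar_objective phi prior Q <= csiszar_objective phi prior P)%E.

Definition ex_ante_symmetric phi prior P : Prop := f_mean phi prior P uniform.

End Csiszar.

Section APU.
Context {R : realType}.
Implicit Types c : R -> \bar R.

Record perturbation_function (n : nat) c : Prop := {
  perturbation_gtNy : forall t, 0 <= t <= 1 -> (-oo < c t)%E ;
  perturbation_convex : ereal_convex `[0, 1] c ;
  perturbation_lsc : lsc_on `[0, 1] c ;
  perturbation_strict : ereal_strictly_convex (interior (dom `[0, 1] c)) c ;
  perturbation_int : interior (dom `[0, 1] c) n%:R^-1
}.

Definition apu_objective n c (theta : 'rV[R]_n) (p : 'I_n -> R) : \bar R :=
  (\sum_a ((p a * theta 0 a)%:E - c (p a)))%E.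

Definition apu_optimal n (Theta : {fset 'rV[R]_n}) c
    (P : Theta -> 'I_n -> R) : Prop :=
  forall theta, simplex (P theta) /\
  forall p, simplex p ->
    (apu_objective c (val theta) p <= apu_objective c (val theta) (P theta))%E.

Definition perturbation_of (n : nat) (phi : R -> \bar R) : R -> \bar R :=
  fun t => ((n%:R^-1)%:E * phi (n%:R * t)%R)%E.

End APU.

(* Main.v *)
Require Import Defs.
From HB Require Import structures.
From mathcomp Require Import all_boot all_order all_algebra perm finmap ring lra.
From mathcomp Require Import all_classical all_reals all_analysis.

Set Implicit Arguments.
Unset Strict Implicit.
Unset Printing Implicit Defensive.

Import Order.TTheory GRing.Theory Num.Theory.
Import numFieldNormedType.Exports.

Local Open Scope classical_set_scope.
Local Open Scope ring_scope.

(* Write F(Q, alpha) for the expected utility of Q minus its Csiszar cost at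
   alpha. F(Q, uniform) is the prior-weighted sum of the APU objectives, and as
   the prior has full support, P is APU-optimal iff it maximizes F(_, uniform).
   If uniform is an f-mean of an optimal P, then
   F(Q, uniform) <= F(Q) <= F(P) = F(P, uniform), where F(Q) is the Csiszar
   objective. Conversely, average Q over the cyclic relabelings of the actions:
   by homogeneity the expected utility is unchanged, and since the perspective
   of phi is subadditive (Jensen with weights alpha) the cost of the average at
   uniform is at most the cost of Q at alpha. Hence an APU-optimal P maximizes
   F(Q, alpha) jointly, at alpha = uniform. *)

(** * Convexity, semicontinuity and interiors under rescaling of argument and value *)

Section Rescaling.
Context {R : realType}.
Implicit Types (A B D E : set R) (f : R -> \bar R) (k b : R).

(** In the subspace topology a point of [D] has the traces on [D] of its neighbourhoods, while a
    point outside [D] is isolated, so the condition is trivial there. *)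
Lemma lsc_onP D f : lsc_on D f <->
  forall x a, D x -> (a%:E < f x)%E -> \forall y \near x, D y -> (a%:E < f y)%E.
Proof.
split=> [lf x a Dx afx|lf x a afx].
  have [V xV Vf] := lf x a afx.
  move: xV; rewrite /nbhs /= -nbhs_subspace_in// => xV.
  exact: filterS xV.
have [Dx|nDx] := pselect (D x).
  exists [set y | (a%:E < f y)%E] => //.
  by rewrite /nbhs /= -nbhs_subspace_in//; exact: lf.
exists [set x]; last by move=> y ->.
by rewrite /nbhs /= -nbhs_subspace_out.
Qed.

Lemma near_scale k x A : (\forall y \near k * x, A y) ->
  \forall y \near x, A (k * y).
Proof. by move=> kxA; have /(_ _ kxA) := @mulrl_continuous R k x. Qed.

Lemma interior_scale k A B x : k != 0 -> (forall t, A t -> B (k * t)) ->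
  interior A x -> interior B (k * x).
Proof.
move=> k0 AB; rewrite /interior /=.
rewrite -{1}(mulKf k0 x) => /near_scale; apply: filterS => y /AB.
by rewrite mulVKf.
Qed.

(** [f] is nonnegative on [E], so the factor [b] distributes over the sum in [\bar R] even when a
    value is [+oo]. *)
Lemma ereal_convex_scale k b D E f :
  0 <= b -> (forall t, D t -> E (k * t)) -> (forall t, E t -> (0 <= f t)%E) ->
  ereal_convex E f -> ereal_convex D (fun t => (b%:E * f (k * t)%R)%E).
Proof.
move=> b0 DE f0 cf x y l Dx Dy l01.
have fx0 := f0 _ (DE _ Dx); have fy0 := f0 _ (DE _ Dy).
have /andP[l0 l1] := l01.
rewrite muleCA (muleCA (1 - l)%:E) -ge0_muleDr ?mule_ge0 ?lee_fin ?subr_ge0//.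
rewrite lee_wpmul2l ?lee_fin//.
rewrite mulrDr mulrCA (mulrCA k); apply: cf => //; exact: DE.
Qed.

Lemma ereal_strictly_convex_scale k b A B f :
  k != 0 -> 0 < b -> (forall t, A t -> B (k * t)) ->
  (forall t, B t -> (0 <= f t)%E) ->
  ereal_strictly_convex B f ->
  ereal_strictly_convex A (fun t => (b%:E * f (k * t)%R)%E).
Proof.
move=> k0 b0 AB f0 cf x y l Ax Ay xy l01.
have fx0 := f0 _ (AB _ Ax); have fy0 := f0 _ (AB _ Ay).
have /andP[l0 l1] := l01.
rewrite muleCA (muleCA (1 - l)%:E).
rewrite -ge0_muleDr ?mule_ge0 ?lee_fin ?subr_ge0 ?(ltW l0) ?(ltW l1)//.
rewrite lte_pmul2l ?lte_fin//.
rewrite mulrDr mulrCA (mulrCA k); apply: cf => //; try exact: AB.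
by rewrite (inj_eq (mulfI k0)).
Qed.

Lemma lsc_on_scale k b D E f : 0 < b -> (forall t, D t -> E (k * t)) ->
  lsc_on E f -> lsc_on D (fun t => (b%:E * f (k * t)%R)%E).
Proof.
move=> b0 DE /lsc_onP lf; apply/lsc_onP => x a Dx.
have scaleE t : (a%:E < b%:E * f t)%E = ((b^-1 * a)%:E < f t)%E.
  by rewrite -(@lte_pmul2l _ b^-1%:E) ?lte_fin ?invr_gt0// -EFinM muleA -EFinM
     mulVf ?gt_eqF// mul1e.
rewrite scaleE => /(lf _ _ (DE _ Dx)) /near_scale; apply: filterS => y fy Dy.
by rewrite scaleE; exact/fy/DE.
Qed.

End Rescaling.

(** * The perspective of [phi] and its subadditivity *)

Section Perspective.
Context {R : realType} (phi : R -> \bar R).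
Hypothesis cphi : csiszar_transformation phi.

Let phi_ge0 t : 0 <= t -> (0 <= phi t)%E .
Proof. exact: csiszar_ge0 cphi t. Qed.

Lemma perspective_at0 x : 0 <= x ->
  perspective phi x 0 = if x == 0 then 0%E else +oo%E.
Proof.
move=> x0; rewrite /perspective eqxx; case: eqVneq => [->|xN0].
  have -> : (fun t : R => (phi (1 + t * 0)%R * (t^-1)%:E)%E) = cst 0%E.
    by apply/funext => t; rewrite mulr0 addr0 (csiszar_one cphi) mul0e.
  exact: lim_cst.
have {}x0 : 0 < x by rewrite lt_neqAle eq_sym xN0.
apply: cvg_lim => //; apply/cvgeyPge => A.
(* With [s = 1 + t * x], [x / s <= 1 / t] gives [phi s / t >= x * (phi s / s)], so the threshold for
   [phi s / s] is [A / x]. *)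
have /cvgeyPge/(_ (x^-1 * A)) := csiszar_superlinear cphi.
case=> M [_ PM].
near=> t.
have t0 : 0 < t by near: t; exact: nbhs_pinfty_gt.
have Mt : M < 1 + t * x.
  rewrite -ltrBlDl -ltr_pdivrMr//; near: t; apply: nbhs_pinfty_gt.
  by rewrite num_real.
have s0 : 0 < 1 + t * x by rewrite addr_gt0// mulr_gt0.
have := PM _ Mt => /= Hs.
have : (x%:E * (x^-1 * A)%:E <= x%:E * (phi (1 + t * x)%R * (1 + t * x)^-1%:E))%E.
  by rewrite lee_pmul2l ?lte_fin.
rewrite -EFinM mulVKf// => /le_trans; apply.
rewrite muleCA; apply: lee_wpmul2l; first by rewrite phi_ge0 ?ltW.
rewrite -EFinM lee_fin.
by rewrite ler_pdivrMr// ler_pdivlMl// mulrC lerDr.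
Unshelve. all: by end_near.
Qed.

Lemma perspective_ge0 x a : 0 <= x -> 0 <= a -> (0 <= perspective phi x a)%E.
Proof.
move=> x0 a0; have [->|aN0] := eqVneq a 0.
  by rewrite perspective_at0//; case: ifP.
by rewrite /perspective (negbTE aN0) mule_ge0 ?lee_fin ?phi_ge0 ?divr_ge0.
Qed.

(** For positive weights this is convexity at [x / a] and [y / b] with weights [a / (a + b)] and
    [b / (a + b)], multiplied by [a + b]. A zero weight contributes nothing if its mass is zero, and
    [+oo] otherwise. *)
Lemma perspective_subadditive x a y b : 0 <= x -> 0 <= a -> 0 <= y -> 0 <= b ->
  (perspective phi (x + y) (a + b) <= perspective phi x a + perspective phi y b)%E.
Proof.
move=> x0 a0 y0 b0.
have px := perspective_ge0 x0 a0; have py := perspective_ge0 y0 b0.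
have [az|aN0] := eqVneq a 0.
  move: px; rewrite az perspective_at0//; case: ifPn => [/eqP ->|xN0] _.
    by rewrite !add0r.
  by rewrite addye ?leey// gt_eqF// (lt_le_trans _ py).
have [bz|bN0] := eqVneq b 0.
  move: py; rewrite bz perspective_at0//; case: ifPn => [/eqP ->|yN0] _.
    by rewrite !addr0.
  by rewrite addey ?leey// gt_eqF// (lt_le_trans _ px).
have {aN0}a_gt0 : 0 < a by rewrite lt_neqAle eq_sym aN0.
have {bN0}b_gt0 : 0 < b by rewrite lt_neqAle eq_sym bN0.
have ab_gt0 : 0 < a + b by rewrite addr_gt0.
rewrite /perspective !gt_eqF//.
have xa0 : 0 <= x / a by rewrite divr_ge0.
have yb0 : 0 <= y / b by rewrite divr_ge0.
have l01 : 0 <= a / (a + b) <= 1.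
  by rewrite divr_ge0 ?(ltW a_gt0) ?(ltW ab_gt0)//= ler_pdivrMr// mul1r lerDl ltW.
have := @csiszar_convex _ _ cphi (x / a) (y / b) (a / (a + b)).
rewrite /= !in_itv/= !andbT => /(_ xa0 yb0 l01).
have -> : a / (a + b) * (x / a) + (1 - a / (a + b)) * (y / b) = (x + y) / (a + b).
  by field; rewrite !gt_eqF.
have -> : 1 - a / (a + b) = b / (a + b) by field; rewrite gt_eqF.
rewrite -(@lee_pmul2l _ (a + b)%:E) ?lte_fin// => /le_trans; apply.
have ?: 0 <= a / (a + b) by case/andP: l01.
have ?: 0 <= b / (a + b) by rewrite divr_ge0 ?(ltW ab_gt0).
rewrite ge0_muleDr ?mule_ge0 ?phi_ge0//.
by rewrite !muleA -!EFinM !(mulrCA (a + b)) !divff ?gt_eqF// !mulr1.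
Qed.

Lemma perspective_sum (I : Type) (r : seq I) (x a : I -> R) :
  (forall i, 0 <= x i) -> (forall i, 0 <= a i) ->
  (perspective phi (\sum_(i <- r) x i) (\sum_(i <- r) a i) <=
   \sum_(i <- r) perspective phi (x i) (a i))%E.
Proof.
move=> x0 a0; elim: r => [|i r IH].
  by rewrite !big_nil perspective_at0// eqxx.
rewrite !big_cons; apply: le_trans (perspective_subadditive _ _ _ _) _ => //.
- exact: sumr_ge0.
- exact: sumr_ge0.
- by rewrite leeD2l.
Qed.

End Perspective.

(** Costs may be [+oo], so objectives are compared as sums, each cost moved to the other side. *)
Lemma lee_subr_swap {R : realType} (a b : R) (x y : \bar R) :
  (0 <= x)%E -> (0 <= y)%E ->
  (a%:E - x <= b%:E - y)%E = (a%:E + y <= b%:E + x)%E.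
Proof.
case: x => [x||] //= _; case: y => [y||] //= _.
  by rewrite -!EFinD !lee_fin lerBlDr addrAC lerBrDr.
by rewrite addeNy addey// leNye leey.
Qed.

Lemma uniform_simplex {R : realType} {T : finType} : (0 < #|T|)%N ->
  simplex (@uniform R T).
Proof.
move=> T0; split=> [a|]; first by rewrite /uniform invr_ge0.
rewrite /uniform sumr_const -[RHS](@mulVf _ #|T|%:R) ?mulr_natr//.
by rewrite pnatr_eq0 -lt0n.
Qed.

(** * APU optimality as maximization with [alpha] fixed at [uniform] *)

Section UniformMean.
Context {R : realType} {n : nat} {Theta : {fset 'rV[R]_n.+1}}.
Variables (prior : Theta -> R) (phi : R -> \bar R).
Hypothesis prior_full : full_support_prior prior.
Hypothesis cphi : csiszar_transformation phi.
Implicit Types (P Q : Theta -> 'I_n.+1 -> R) (alpha : 'I_n.+1 -> R).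

Local Notation c := (perturbation_of n.+1 phi).
Local Notation cost := (csiszar_cost phi prior).

Let prior_gt0 theta : 0 < prior theta.
Proof. by case: prior_full. Qed.

Let prior_ge0 theta : 0 <= prior theta.
Proof. exact: ltW. Qed.

Let c_ge0 t : 0 <= t -> (0 <= c t)%E.
Proof.
move=> t0; rewrite mule_ge0 ?lee_fin//; apply: csiszar_ge0 cphi _ _.
by rewrite mulr_ge0.
Qed.

Definition apu_cost (p : 'I_n.+1 -> R) : \bar R := (\sum_a c (p a))%E.

Lemma apu_cost_ge0 p : simplex p -> (0 <= apu_cost p)%E.
Proof. by move=> [p0 _]; apply: sume_ge0 => a _; exact: c_ge0. Qed.

Lemma apu_cost_uniform : apu_cost uniform = 0%E.
Proof.
rewrite /apu_cost big1// => a _.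
rewrite /perturbation_of /uniform card_ord divff ?pnatr_eq0//.
by rewrite (csiszar_one cphi) mule0.
Qed.

Lemma apu_objectiveE (theta : 'rV[R]_n.+1) p : simplex p ->
  apu_objective c theta p = ((\sum_a p a * theta 0 a)%:E - apu_cost p)%E.
Proof.
move=> [p0 _]; rewrite /apu_objective big_split/= sumEFin sumeN// => a b _ _.
by rewrite ge0_adde_def// inE c_ge0.
Qed.

(** The weight that [uniform] gives each action turns the perspective of [phi] into [c]; this is
    where the formula for [c] comes from. *)
Lemma csiszar_cost_uniform P :
  cost P uniform = (\sum_theta (prior theta)%:E * apu_cost (P theta))%E.
Proof.
apply: eq_bigr => theta _; congr (_ * _)%E; apply: eq_bigr => a _.
by rewrite /perspective /uniform card_ord invr_eq0 pnatr_eq0 invrK mulrC.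
Qed.

Lemma csiszar_cost_ge0 P alpha : choice_rule P -> simplex alpha ->
  (0 <= cost P alpha)%E.
Proof.
move=> cP [alpha0 _]; apply: sume_ge0 => theta _.
rewrite mule_ge0 ?lee_fin//; apply: sume_ge0 => a _.
by apply: perspective_ge0 => //; have [] := cP theta.
Qed.

Lemma csiszar_information_f_mean P alpha : f_mean phi prior P alpha ->
  csiszar_information phi prior P = cost P alpha.
Proof.
move=> [salpha le_alpha]; apply/le_anti/andP; split.
  by apply: ereal_inf_lbound; exists alpha.
by apply: le_ereal_inf_tmp => _ [beta sbeta <-]; exact: le_alpha.
Qed.

Lemma utilityD_cost Q P : choice_rule P ->
  ((expected_utility prior Q)%:E + cost P uniform)%E =
  (\sum_theta (prior theta)%:E *
    ((\sum_a Q theta a * val theta 0 a)%:E + apu_cost (P theta)))%E.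
Proof.
move=> cP; rewrite csiszar_cost_uniform -sumEFin -big_split/=.
by apply: eq_bigr => theta _; rewrite muleDr// fin_num_adde_defr.
Qed.

(** Maximality of expected utility minus cost at [uniform], with costs on opposite sides so that
    nothing infinite is subtracted. *)
Definition jointly_optimal P := forall Q, choice_rule Q ->
  ((expected_utility prior Q)%:E + cost P uniform <=
   (expected_utility prior P)%:E + cost Q uniform)%E.

(** Forward, the statewise inequalities are summed with prior weights. Backward, [P] is altered in
    one state and the finite terms of the other states cancel. *)
Lemma apu_optimalP P : choice_rule P -> apu_optimal c P <-> jointly_optimal P.
Proof.
move=> cP; split=> [optP Q cQ|optP theta].
  rewrite !utilityD_cost//; apply: lee_sum => theta _.
  rewrite lee_pmul2l ?lte_fin// -lee_subr_swap ?apu_cost_ge0//.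
  by rewrite -!apu_objectiveE//; exact: (optP theta).2.
split=> // q sq.
(* The uniform rule has cost zero, so comparison with it bounds the cost of [P]. *)
have cost_fin : (cost P uniform < +oo)%E.
  have cU : @choice_rule R n.+1 Theta (fun=> uniform).
    by move=> t; apply: uniform_simplex; rewrite card_ord.
  have := optP _ cU; rewrite (csiszar_cost_uniform (fun=> uniform)).
  rewrite big1; last by move=> t _; rewrite apu_cost_uniform mule0.
  by case: (cost P uniform) => // r; rewrite ltry.
have apu_fin t : apu_cost (P t) \is a fin_num.
  rewrite ge0_fin_numE ?apu_cost_ge0//.
  move: cost_fin; rewrite csiszar_cost_uniform (bigD1 t)//=.
  have := apu_cost_ge0 (cP t); case: (apu_cost (P t)) => [r||] // _.
    by rewrite ltry.
  rewrite gt0_muley ?lte_fin// addye// gt_eqF// (@lt_le_trans _ _ 0%E)//.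
  by apply: sume_ge0 => t' _; rewrite mule_ge0 ?lee_fin ?apu_cost_ge0.
rewrite !apu_objectiveE// lee_subr_swap ?apu_cost_ge0//.
pose Q t := if t == theta then q else P t.
have cQ : choice_rule Q by move=> t; rewrite /Q; case: ifP.
have := optP Q cQ; rewrite !utilityD_cost// (bigD1 theta)//= [leRHS](bigD1 theta)//=.
have -> : Q theta = q by rewrite /Q eqxx.
have QP t : t != theta -> Q t = P t by rewrite /Q => /negbTE ->.
(* Away from [theta], [Q] equals [P]: the two remaining sums become identical and, being finite,
   cancel. *)
rewrite [X in (_ <= _ + X)%E -> _](eq_bigr (fun t => (prior t)%:E *
  ((\sum_a Q t a * val t 0 a)%:E + apu_cost (P t)))%E); last first.
  by move=> t tN; rewrite QP.
rewrite leeD2rE; last first.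
  by apply/sum_fin_numP => t _ _; rewrite fin_numM// fin_numD apu_fin.
by rewrite lee_pmul2l ?lte_fin.
Qed.

End UniformMean.

(** * Averaging a choice rule over cyclic relabelings of the actions *)

Section Symmetrization.
Context {R : realType} {n : nat} {Theta : {fset 'rV[R]_n.+1}}.
Variables (prior : Theta -> R).
Hypothesis prior_full : full_support_prior prior.
Hypothesis prior_hom : a_priori_homogeneous prior.
Implicit Types (Q : Theta -> 'I_n.+1 -> R) (alpha : 'I_n.+1 -> R).

(** Addition in ['I_n.+1] is modulo [n.+1]. Cyclic shifts suffice in place of all permutations,
    because [a - k] runs through every action as [k] varies. *)
Definition shift (k : 'I_n.+1) : {perm 'I_n.+1} := perm (@addIr _ k).

Definition shift_state k theta : Theta :=
  sval (cid2 (prior_hom theta (shift k))).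

Lemma val_shift_state k theta a :
  val (shift_state k theta) 0 a = val theta 0 (a + k).
Proof. by rewrite /shift_state; case: cid2 => t /= -> _; rewrite mxE permE. Qed.

Lemma prior_shift_state k theta : prior (shift_state k theta) = prior theta.
Proof. by rewrite /shift_state; case: cid2. Qed.

Lemma shift_state_inj k : injective (shift_state k).
Proof.
move=> t1 t2 tE; apply/val_inj/rowP => a.
by rewrite -[a](subrK k) -!val_shift_state tE.
Qed.

(** In the state shifted by [k], action [a - k] has the utility that [a] has in [theta], so each
    summand is [Q] under a relabeling. *)
Definition symmetrization Q : Theta -> 'I_n.+1 -> R := fun theta a =>
  n.+1%:R^-1 * \sum_k Q (shift_state k theta) (a - k).

Lemma reindex_shift {V : nmodType} (F : 'I_n.+1 -> V) k :
  \sum_a F (a - k) = \sum_a F a.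
Proof. by rewrite [RHS](reindex_inj (@addIr _ (- k))). Qed.

Lemma reindex_shift_state {V : nmodType} (F : Theta -> V) k :
  \sum_theta F (shift_state k theta) = \sum_theta F theta.
Proof. by rewrite [RHS](reindex_inj (@shift_state_inj k)). Qed.

Lemma symmetrization_rule Q : choice_rule Q -> choice_rule (symmetrization Q).
Proof.
move=> cQ theta; split=> [a|].
  by rewrite mulr_ge0//; apply: sumr_ge0 => k _; have [] := cQ (shift_state k theta).
rewrite -mulr_sumr exchange_big/=.
under eq_bigr => k _ do rewrite reindex_shift (cQ _).2.
by rewrite sumr_const card_ord mulVf// pnatr_eq0.
Qed.

Lemma symmetrization_utility Q :
  expected_utility prior (symmetrization Q) = expected_utility prior Q.
Proof.
transitivity (n.+1%:R^-1 * \sum_(k < n.+1) expected_utility prior Q); last first.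
  by rewrite sumr_const card_ord -(mulr_natl (expected_utility _ _)) mulKf// pnatr_eq0.
rewrite mulr_sumr.
(* The [k]-th of [n.+1] equal copies is reindexed by the shift by [k], here over states and below
   over actions; the prior is invariant. *)
under [RHS]eq_bigr => k _ do
  rewrite /expected_utility -(reindex_shift_state _ k) mulr_sumr.
rewrite exchange_big/=; apply: eq_bigr => theta _.
under [RHS]eq_bigr => k _ do
  rewrite prior_shift_state mulrCA -(reindex_shift _ k) mulr_sumr.
rewrite -mulr_sumr exchange_big/=; congr (_ * _); apply: eq_bigr => a _.
rewrite /symmetrization -mulrA mulr_suml mulr_sumr; apply: eq_bigr => k _.
by rewrite val_shift_state subrK.
Qed.

Variable phi : R -> \bar R.
Hypothesis cphi : csiszar_transformation phi.

Lemma symmetrization_cost Q alpha : choice_rule Q -> simplex alpha ->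
  (csiszar_cost phi prior (symmetrization Q) uniform <=
   csiszar_cost phi prior Q alpha)%E.
Proof.
move=> cQ [alpha0 alpha1].
have Q0 theta a : 0 <= Q theta a by have [] := cQ theta.
have prior0 theta : 0 <= prior theta by exact/ltW/(prior_full.2).
have N0 : n.+1%:R != 0 :> R by rewrite pnatr_eq0.
have persp0 theta a : (0 <= perspective phi (Q theta a) (alpha a))%E.
  exact: perspective_ge0.
pose G k theta a :=
  perspective phi (Q (shift_state k theta) (a - k)) (alpha (a - k)).
(* The weights [alpha (a - k)] sum to 1 over [k], so [phi] at [n.+1] times the averaged probability
   is a perspective of total weight 1, and subadditivity applies. *)
have jensen theta a : (perturbation_of n.+1 phi (symmetrization Q theta a) <=
    n.+1%:R^-1%:E * \sum_k G k theta a)%E.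
  rewrite lee_pmul2l ?lte_fin ?invr_gt0 ?ltr0n//.
  have -> : phi (n.+1%:R * symmetrization Q theta a) =
      perspective phi (\sum_k Q (shift_state k theta) (a - k))
                      (\sum_k alpha (a - k)).
    have -> : \sum_k alpha (a - k) = 1.
      have inj : injective (fun k : 'I_n.+1 => a - k) by move=> ? ? /addrI/oppr_inj.
      by rewrite -alpha1 [RHS](reindex_inj inj).
    by rewrite /perspective oner_eq0 divr1 mul1e /symmetrization mulVKf.
  exact: perspective_sum.
(* As for the utility, [n.+1] copies of the cost are each reindexed by their own shift, to match the
   sum over [k] in [jensen]. *)
have -> : csiszar_cost phi prior Q alpha =
    (n.+1%:R^-1%:E * \sum_(k < n.+1) csiszar_cost phi prior Q alpha)%E.
  by rewrite sumr_const card_ord -[X in (_ * X)%E]mule_natl muleA -EFinM mulVf// mul1e.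
rewrite csiszar_cost_uniform.
under [in leRHS]eq_bigr => k _ do rewrite /csiszar_cost -(reindex_shift_state _ k).
rewrite exchange_big/= ge0_sume_distrr; last first.
  move=> theta _; apply: sume_ge0 => k _; rewrite mule_ge0 ?lee_fin//.
  by apply: sume_ge0 => a _.
apply: lee_sum => theta _.
under [in leRHS]eq_bigr => k _ do rewrite prior_shift_state -(reindex_shift _ k).
rewrite -ge0_sume_distrr; last by move=> k _; apply: sume_ge0 => a _.
rewrite muleCA; apply: lee_wpmul2l; first by rewrite lee_fin.
rewrite exchange_big/= ge0_sume_distrr; last first.
  by move=> a _; apply: sume_ge0 => k _.
by apply: lee_sum => a _; exact: jensen.
Qed.

Lemma symmetric_optimalP P : choice_rule P ->
  (ex_ante_symmetric phi prior P /\ csiszar_optimal phi prior P) <->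
  apu_optimal (perturbation_of n.+1 phi) P.
Proof.
move=> cP; have simU : @simplex R 'I_n.+1 uniform.
  by apply: uniform_simplex; rewrite card_ord.
have cost0 Q : choice_rule Q -> (0 <= csiszar_cost phi prior Q uniform)%E.
  by move=> cQ; exact: csiszar_cost_ge0.
have info0 Q : choice_rule Q -> (0 <= csiszar_information phi prior Q)%E.
  by move=> cQ; apply: le_ereal_inf_tmp => _ [alpha sa <-]; exact: csiszar_cost_ge0.
rewrite (apu_optimalP prior_full cphi cP); split=> [[symP [_ optP]] Q cQ|optP].
  have := optP Q cQ; rewrite /csiszar_objective (csiszar_information_f_mean symP).
  rewrite lee_subr_swap ?info0 ?cost0// => /le_trans; apply.
  by rewrite leeD2l//; apply: ereal_inf_lbound; exists uniform.
(* The bound holds for every [alpha]: taking [Q = P] yields the f-mean, and the infimum over [alpha]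
   yields optimality. *)
have optP_joint Q alpha : choice_rule Q -> simplex alpha ->
    ((expected_utility prior Q)%:E + csiszar_cost phi prior P uniform <=
     (expected_utility prior P)%:E + csiszar_cost phi prior Q alpha)%E.
  move=> cQ sa; have := optP _ (symmetrization_rule cQ).
  rewrite symmetrization_utility => /le_trans; apply.
  by rewrite leeD2l// symmetrization_cost.
have symP : ex_ante_symmetric phi prior P.
  split=> // alpha sa; have := optP_joint P alpha cP sa.
  by rewrite leeD2lE.
split=> //; split=> // Q cQ.
rewrite /csiszar_objective (csiszar_information_f_mean symP).
rewrite lee_subr_swap ?info0 ?cost0// -leeBlDl//.
apply: le_ereal_inf_tmp => _ [alpha sa <-].
by rewrite leeBlDl// optP_joint.
Qed.

End Symmetrization.

(** * Passing between [phi] and [c] *)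

Section Correspondence.
Context {R : realType} (n : nat).
Implicit Types (phi c : R -> \bar R).

(** [1 < n] places [1/n] in the interior of [[0, 1]]; the other properties are those of [phi] on
    [[0, n]], rescaled. *)
Lemma perturbation_of_csiszar phi : (1 < n)%N -> csiszar_transformation phi ->
  perturbation_function n (perturbation_of n phi).
Proof.
move=> n_gt1 cphi; have n0 : 0 < n%:R :> R by rewrite ltr0n ltnW.
have nN0 : n%:R != 0 :> R by rewrite gt_eqF.
have scaleD t : `[0, 1]%classic t -> `[0, +oo[%classic (n%:R * t : R).
  by rewrite /= !in_itv/= andbT => /andP[t0 _]; rewrite mulr_ge0.
have phi0 t : `[0, +oo[%classic t -> (0 <= phi t)%E.
  by rewrite /= in_itv/= andbT => t0; exact: csiszar_ge0 cphi _ t0.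
have domE t : (perturbation_of n phi t < +oo)%E = (phi (n%:R * t)%R < +oo)%E.
  rewrite -[X in (_ < X)%E = _](@gt0_muley _ n%:R^-1%:E) ?lte_fin ?invr_gt0//.
  by rewrite lte_pmul2l ?lte_fin ?invr_gt0.
split.
- move=> t t01; rewrite (@lt_le_trans _ _ 0%E) ?ltNy0//.
  by rewrite mule_ge0 ?lee_fin ?invr_ge0//; apply/phi0/scaleD; rewrite /= in_itv.
- apply: ereal_convex_scale scaleD phi0 (csiszar_convex cphi).
  by rewrite invr_ge0.
- by apply: lsc_on_scale scaleD (csiszar_lsc cphi); rewrite invr_gt0.
- apply: ereal_strictly_convex_scale (csiszar_strict cphi) => //.
  + by rewrite invr_gt0.
  + move=> t; apply: interior_scale => // {}t [t01 tfin].
    by split; [exact: scaleD|rewrite -domE].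
  + by move=> t /interior_subset[tD _]; exact: phi0.
(* Dividing a point of the domain of [phi] by [n] may lead outside [[0, 1]], so the complement is
   adjoined first and then removed on a neighbourhood of [1/n] inside [[0, 1]]. *)
- have phi1 : interior (dom `[0, 1] (perturbation_of n phi) `|` ~` `[0, 1]) n%:R^-1.
    rewrite -[n%:R^-1]mulr1; apply: interior_scale (csiszar_int1 cphi).
      by rewrite invr_eq0.
    move=> t [tD tfin]; have [t01|] := pselect (`[0, 1]%classic (n%:R^-1 * t));
      last by right.
    by left; split=> //; rewrite domE mulVKf.
  have : interior (`[0, 1]%classic : set R) n%:R^-1.
    rewrite interior_itv_bnd /= in_itv/= invr_gt0 n0/=.
    by rewrite invf_lt1// ltr1n.
  rewrite /interior/=; move: phi1; apply: filterS2 => t [//|nt01 t01].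
  by case: nt01.
Qed.

(* Beyond n the values of phi are unconstrained by c; +oo makes phi superlinear
   without enlarging its domain. *)
Definition csiszar_of c : R -> \bar R := fun t =>
  if t <= n%:R then (n%:R%:E * c (n%:R^-1 * t)%R)%E else +oo%E.

(** Zero is a subgradient at a point of value zero, so [c >= 0], which gives the sign of [phi]. The
    rest rescales [c] on [[0, n]] and treats the value [+oo] beyond [n] apart. *)
Lemma csiszar_ofP c : (0 < n)%N -> perturbation_function n c ->
  c n%:R^-1 = 0%E -> subdifferential `[0, 1] c n%:R^-1 0 ->
  csiszar_transformation (csiszar_of c) /\
  forall t, 0 <= t <= 1 -> c t = perturbation_of n (csiszar_of c) t.
Proof.
move=> n_gt0 pc c1 dc; have n0 : 0 < n%:R :> R by rewrite ltr0n.
have nN0 : n%:R != 0 :> R by rewrite gt_eqF.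
have nV0 : n%:R^-1 != 0 :> R by rewrite invr_eq0.
have c0 t : `[0, 1]%classic t -> (0 <= c t)%E.
  by move=> t01; have := dc t t01; rewrite c1 mul0r add0e.
have scaleD t : `[0, n%:R]%classic t -> `[0, 1]%classic (n%:R^-1 * t : R).
  rewrite /= !in_itv/= => /andP[t0 tn].
  by rewrite mulr_ge0 ?invr_ge0//= ler_pdivrMl// mulr1.
pose g t := (n%:R%:E * c (n%:R^-1 * t)%R)%E.
have inE t : t <= n%:R -> csiszar_of c t = g t by rewrite /csiszar_of => ->.
have outE t : n%:R < t -> csiszar_of c t = +oo%E.
  by rewrite /csiszar_of => /lt_geF ->.
have ge0 t : 0 <= t -> (0 <= csiszar_of c t)%E.
  rewrite /csiszar_of => t0; case: ifP => // tn.
  by rewrite mule_ge0// ?lee_fin//; apply/c0/scaleD; rewrite /= in_itv/= t0.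
have domE t : dom `[0, +oo[ (csiszar_of c) t ->
    dom `[0, 1] c (n%:R^-1 * t) /\ t <= n%:R.
  move=> [/=]; rewrite in_itv/= andbT => t0.
  have [tn|tn] := leP t n%:R; last by rewrite outE// ltxx.
  rewrite inE// -[X in (_ < X)%E -> _](@gt0_muley _ n%:R%:E) ?lte_fin//.
  rewrite lte_pmul2l ?lte_fin// => ct; split=> //; split=> //.
  by apply: scaleD; rewrite /= in_itv/= t0.
split; last first.
  move=> t /andP[t0 t1]; rewrite /perturbation_of inE; last first.
    by rewrite -[leRHS]mulr1 ler_pM2l.
  by rewrite /g mulKf// muleA -EFinM mulVf// mul1e.
split.
- exact: ge0.
- move=> x y l; rewrite /= !in_itv/= !andbT => x0 y0 l01.
  have /andP[l0 l1] := l01.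
  (* Since [0 * +oo = 0], the extreme values of [l] are set apart; for the others a point beyond [n]
     makes the right side [+oo]. *)
  have [->|lN0] := eqVneq l 0.
    by rewrite !mul0r !add0r subr0 !mul1r mul1e mul0e add0e.
  have [->|lN1] := eqVneq l 1.
    by rewrite subrr !mul0r !addr0 !mul1r mul1e mul0e adde0.
  have {}l0 : 0 < l by rewrite lt_neqAle eq_sym lN0.
  have {}l1 : 0 < 1 - l by rewrite subr_gt0 lt_neqAle lN1.
  have [xn|xn] := leP x n%:R; last first.
    rewrite (outE x)// gt0_muley ?lte_fin// addye ?leey// gt_eqF//.
    by rewrite (@lt_le_trans _ _ 0%E)// mule_ge0 ?ge0// lee_fin ltW.
  have [yn|yn] := leP y n%:R; last first.
    rewrite (outE y)// gt0_muley ?lte_fin// addey ?leey// gt_eqF//.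
    by rewrite (@lt_le_trans _ _ 0%E)// mule_ge0 ?ge0// lee_fin ltW.
  rewrite !inE//; last by nra.
  have := @ereal_convex_scale _ n%:R^-1 n%:R `[0, n%:R]%classic _ _ (ltW n0)
    scaleD c0 (perturbation_convex pc) x y l.
  by rewrite /= !in_itv/= x0 y0 xn yn => /(_ isT isT l01).
- have /lsc_onP lg : lsc_on `[0, n%:R]%classic g.
    exact: lsc_on_scale scaleD (perturbation_lsc pc).
  apply/lsc_onP => x a /=; rewrite in_itv/= andbT => x0.
  have [xn|nx] := leP x n%:R.
    rewrite inE// => /lg; rewrite /= in_itv/= x0 xn => /(_ isT).
    apply: filterS => y gy; rewrite in_itv/= andbT => y0.
    have [yn|ny] := leP y n%:R; last by rewrite outE// ltry.
    by rewrite inE//; apply: gy; rewrite in_itv/= y0.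
  move=> _; near=> y => _; rewrite outE ?ltry//.
  by near: y; exact: lt_nbhsr.
- by rewrite inE ?ler1n// /g mulr1 c1 mule0.
- apply/cvgeyPge => A; near=> t.
  have tn : n%:R < t by near: t; apply: nbhs_pinfty_gt; rewrite num_real.
  by rewrite outE// gt0_mulye ?leey// lte_fin invr_gt0 (lt_trans n0).
- move=> x y l xD yD xy l01.
  (* Finiteness of [csiszar_of c] forces [t <= n], so the interior of its domain rescales into that
     of [c], where strict convexity is available. *)
  have sub t : interior (dom `[0, +oo[ (csiszar_of c)) t ->
      interior (dom `[0, 1] c) (n%:R^-1 * t).
    by apply: interior_scale => // {}t /domE[].
  have le_n t : interior (dom `[0, +oo[ (csiszar_of c)) t -> t <= n%:R.
    by move=> /interior_subset /domE[].
  have xn := le_n x xD; have yn := le_n y yD; case/andP: (l01) => l0 l1.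
  rewrite !inE//; last by nra.
  apply: ereal_strictly_convex_scale (perturbation_strict pc) _ _ _ xD yD xy l01 => //.
  by move=> t /interior_subset[tD _]; exact: c0.
- rewrite -[1](mulfV nN0); apply: interior_scale (perturbation_int pc) => //.
  move=> t [/= t01 tfin]; move: (t01); rewrite in_itv/= => /andP[t0 t1].
  split; first by rewrite /= in_itv/= andbT mulr_ge0.
  rewrite inE; last by rewrite -[leRHS]mulr1 ler_pM2l.
  rewrite /g mulKf// -[X in (_ < X)%E](@gt0_muley _ n%:R%:E) ?lte_fin//.
  by rewrite lte_pmul2l ?lte_fin.
Unshelve. all: by end_near.
Qed.

End Correspondence.

Theorem proposition2 (R : realType) (n : nat) (n_gt0 : (0 < n)%N) :
  (forall (Theta : {fset 'rV[R]_n}) (prior : Theta -> R),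
     full_support_prior prior -> a_priori_homogeneous prior ->
   forall phi : R -> \bar R, csiszar_transformation phi ->
   forall P : Theta -> 'I_n -> R, choice_rule P ->
     (ex_ante_symmetric phi prior P /\ csiszar_optimal phi prior P) <->
     apu_optimal (perturbation_of n phi) P) /\
  (forall phi : R -> \bar R, csiszar_transformation phi -> (1 < n)%N ->
     perturbation_function n (perturbation_of n phi)) /\
  (forall c : R -> \bar R, perturbation_function n c ->
     c n%:R^-1 = 0%E -> subdifferential `[0, 1] c n%:R^-1 0 ->
   exists phi : R -> \bar R, csiszar_transformation phi /\
     forall t : R, 0 <= t <= 1 -> c t = perturbation_of n phi t).
Proof.
split; last split.
(* For [n = m.+1] the index type is a cyclic group, which the shifts use. *)
- case: n n_gt0 => // m _ Theta prior full hom phi cphi P cP.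
  exact: (symmetric_optimalP full hom cphi cP).
- by move=> phi cphi n_gt1; exact: perturbation_of_csiszar.
- by move=> c pc c1 dc; exists (csiszar_of n c); exact: csiszar_ofP.
Qed.
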